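(* For all integers $n \ge d \ge 2$ and all prime powers $q$, the second Whitney number of the higher-weight Dowling lattice $\mathcal{H}(q,n,d)$ is \begin{align*} w_2(q,n,d) &=(q^{n-1}-1) \sum_{j=1}^d \binom{n}{j} (q-1)^{j-2} \ - \sum_{1 \le \ell_1<\ell_2 \le n} \Biggl[ q^{n-\ell_1-1}\left( \sum_{j=0}^{d-1} \binom{n-\ell_2}{j} (q-1)^j\right) \\ &\quad + \sum_{j=d}^{n-\ell_2}\sum_{h=0}^{d-1} \binom{n-\ell_2}{j} \binom{n-\ell_1-1}{h}(q-1)^{j+h} \\ &\quad + \sum_{s=d}^{n-\ell_2} \ \sum_{t=0}^{d-2} \binom{n-\ell_2}{s} \binom{n-\ell_1-1-s}{t} (q-1)^{s+t} \sum_{\nu=d-t}^s \gamma_q(s,s-d+t+2,\nu) \Biggr], \end{align*} where the $\gamma_a(b,c,\nu)$ are the agreement numbers.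
   Context: Let $q$ be a prime power. The Hamming weight of $v \in \mathbb{F}_q^n$ is the number of its nonzero coordinates. For integers $n,d\ge 1$, the higher-weight Dowling lattice $\mathcal{H}(q,n,d)$ is the set, ordered by inclusion, of all $\mathbb{F}_q$-linear subspaces of $\mathbb{F}_q^n$ that have a basis made of vectors of Hamming weight at most $d$, together with the zero space. It is a finite geometric lattice whose rank function is the $\mathbb{F}_q$-dimension. With $\mu$ the Möbius function of $\mathcal{H}(q,n,d)$, the $i$-th Whitney number (of the first kind) is $w_i(q,n,d)=\sum_{U \in \mathcal{H}(q,n,d),\ \dim U=i} \mu(\{0\},U)$ (an empty sum is $0$). Agreement numbers: for integers $a,b\ge 1$ and $c,\nu\ge 0$, the integer $\gamma_a(b,c,\nu)$ is defined by the initial conditions $\gamma_a(b,c,\nu)=0$ if $a=1$ or $b<c$ or $\nu<c$ or $\nu>b$; $\gamma_a(b,c,\nu)=a-1$ if $a\ge 2$ and $b=c=\nu$; and the recursion (with $0^0=1$) $$\gamma_a(b,c,\nu)=\sum_{s=0}^{c-1}\binom{b}{s}\gamma_{a-1}(b-s,c,\nu-s)+\sum_{s=c}^{\nu}\binom{b}{s}\binom{b-s}{\nu-s}(a-2)^{\nu-s}\quad\text{for } a\ge 2,\ b\ge c+1,\ \nu\ge c.$$ Conventions: sums over empty index sets are $0$; $\binom{x}{y}=0$ if $y>x\ge 0$. *)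

(* Defs.v *)
From HB Require Import structures.
From mathcomp Require Import all_boot all_order all_algebra.

Set Implicit Arguments.
Unset Strict Implicit.
Unset Printing Implicit Defensive.

Import Order.TTheory GRing.Theory Num.Theory.

Local Open Scope ring_scope.

Import VectorInternalTheory.

Section Mobius.
Local Open Scope order_scope.
Variables (disp : Order.disp_t) (T : finPOrderType disp).

Implicit Types x y z : T.

(* [k] is fuel; [mobiusE] below is the defining recursion. *)
Fixpoint mobius_rec (k : nat) x y : int :=
  if k is k'.+1 then
    if x == y then 1%R
    else if x < y then (- \sum_(z : T | (x <= z < y)%O) mobius_rec k' x z)%R
    else 0%R
  else 0%R.

Definition mobius x y : int := mobius_rec #|[set z | z <= y]| x y.

Lemma mobius_rec_stable k x y :
  (#|[set z | (z <= y)%O]| <= k)%N -> mobius_rec k x y = mobius x y.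
Proof.
have card_gt0 t : (0 < #|[set z | (z <= t)%O]|)%N.
  by apply/card_gt0P; exists t; rewrite inE.
suff main m : (#|[set z | (z <= y)%O]| <= k)%N ->
    (#|[set z | (z <= y)%O]| <= m)%N -> mobius_rec k x y = mobius_rec m x y.
  by move=> lek; apply: main.
elim: k m y => [|k IH] [|m] y; rewrite ?(leqNgt _ 0) ?card_gt0 // => lek lem /=.
case: ifP => // _; case: ifP => // _; congr (- _)%R.
apply: eq_bigr => z /andP[_ zy].
have lt : (#|[set t | (t <= z)%O]| < #|[set t | (t <= y)%O]|)%N.
  apply: proper_card; apply/properP; split.
    by apply/subsetP=> t; rewrite !inE => /le_trans; apply; apply: ltW.
  by exists y; rewrite !inE ?lexx // lt_geF.
by apply: IH; rewrite -ltnS (leq_trans lt).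
Qed.

Lemma mobiusE x y :
  mobius x y = if x == y then 1%R
               else if x < y then (- \sum_(z : T | (x <= z < y)%O) mobius x z)%R
               else 0%R.
Proof.
rewrite -(mobius_rec_stable x (leqnSn _)) /=.
case: ifP => // _; case: ifP => // _; congr (- _)%R.
apply: eq_bigr => z /andP[_ zy]; apply: mobius_rec_stable.
apply/subset_leq_card/subsetP=> t; rewrite !inE => /le_trans; apply.
exact: ltW.
Qed.

End Mobius.

HB.instance Definition _ (F : finFieldType) (vT : vectType F) :=
  [Countable of {vspace vT} by <:].
HB.instance Definition _ (F : finFieldType) (vT : vectType F) :=
  [Finite of {vspace vT} by <:].

Definition hamming_weight (F : finFieldType) (n : nat) (v : 'rV[F]_n) : nat :=
  #|[set i | v 0 i != 0]|.

Definition low_weight_space (F : finFieldType) (n d : nat)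
    (U : {vspace 'rV[F]_n}) : bool :=
  (U == 0%VS) ||
  [exists X : (\dim U).-tuple 'rV[F]_n,
     basis_of U X && all (fun v => hamming_weight v <= d)%N X].

Section HigherWeightDowling.
Variables (F : finFieldType) (n d : nat).

Record dowling : predArgType :=
  Dowling { dowling_val :> {vspace 'rV[F]_n}; _ : low_weight_space d dowling_val }.

HB.instance Definition _ := [isSub of dowling for dowling_val].
HB.instance Definition _ := [Finite of dowling by <:].

Definition dowling_le (U V : dowling) : bool := (U <= V)%VS.

Lemma dowling_le_refl : reflexive dowling_le.
Proof. by move=> U; apply: subvv. Qed.

Lemma dowling_le_anti : antisymmetric dowling_le.
Proof. by move=> U V UV; apply/val_inj/eqP; rewrite eqEsubv. Qed.

Lemma dowling_le_trans : transitive dowling_le.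
Proof. by move=> V U W; apply: subv_trans. Qed.

Fact dowling_display : Order.disp_t. Proof. exact: Order.Disp tt tt. Qed.

HB.instance Definition _ := Order.Le_isPOrder.Build dowling_display dowling
  dowling_le_refl dowling_le_anti dowling_le_trans.

Lemma low_weight_space0 : low_weight_space d (0%VS : {vspace 'rV[F]_n}).
Proof. by rewrite /low_weight_space eqxx. Qed.

Definition dowling0 : dowling := Dowling low_weight_space0.

Definition whitney (i : nat) : int :=
  \sum_(U : dowling | \dim U == i) mobius dowling0 U.

End HigherWeightDowling.

Local Open Scope nat_scope.

(* Agreement numbers gamma_a(b, c, nu) for a, b >= 1 and c, nu >= 0; the value
   at a = 0 is junk.  In the last branch a >= 2, b >= c + 1 and c <= nu <= b, so
   no subtraction truncates. *)
Fixpoint agreement (a b c nu : nat) : nat :=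
  if a is a'.+1 then
    if [|| a == 1, b < c, nu < c | b < nu] then 0
    else if (b == c) && (nu == c) then a - 1
    else \sum_(0 <= s < c) 'C(b, s) * agreement a' (b - s) c (nu - s)
         + \sum_(c <= s < nu.+1) 'C(b, s) * 'C(b - s, nu - s) * (a - 2) ^ (nu - s)
  else 0.

(* Main.v *)
Require Import Defs.
From HB Require Import structures.
From mathcomp Require Import all_boot all_order all_algebra all_field zify ring.

Set Implicit Arguments.
Unset Strict Implicit.
Unset Printing Implicit Defensive.

Import Order.TTheory GRing.Theory Num.Theory.
Local Open Scope ring_scope.

(** The second Whitney number is determined by how many low-weight lines each
    plane contains.  Call a nonzero vector low if its Hamming weight is at most
    [d], and let [a(V)] be the number of lines of a plane [V] spanned by a low
    vector.  A plane is in the lattice iff [a(V) >= 2], and then the interval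
    below it is [0], the [a(V)] lines and [V], so its Moebius value is
    [a(V) - 1].  As [a(V) - (a(V) > 0)] vanishes when [a(V) <= 1], the sum can be
    taken over all planes of the ambient space ([whitney2E]):

      [w_2 = sum_V a(V) - #{V | a(V) > 0}].

    The first term counts incident pairs of a low vector and a plane: every
    nonzero vector is on [(q^n - q) / (q^2 - q)] planes and every line has [q - 1]
    nonzero vectors ([sum_low_lines]), while low vectors are counted by weight
    ([card_low_vectors]).

    For the second term, each plane has exactly one reduced row echelon basis
    ([echelon_inj], [echelon_surj]), with pivots [i < k] and rows [e_i + f] and
    [e_k + g], where [f] is supported on the positions after [i] other than [k],
    and [g] on those after [k].  Up to a scalar, a nonzero vector of the plane is
    [e_k + g], or [e_i + f], or [(e_i + f) - a (e_k + g)] with [a != 0].  Hence the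
    plane has a low vector iff [weight g < d], or [weight f < d], or
    [weight (f - a g) + 2 <= d] for some [a != 0] ([low_plane_of]).  The three
    summands of the formula count the pairs by the first of these conditions that
    holds ([sum_low_pair]).

    In the third case split [f] into a part outside the support of [g], of weight
    [t], and a part [h] inside it.  With [s = weight g], the condition says that
    [h / g], a word of length [s], takes some nonzero value [a] at least
    [s - d + t + 2] times ([sum_heavy_light]).  Words of given weight in which some
    nonzero letter is that frequent are what the agreement numbers count
    ([agreement_words]): the recursion removes one letter [l], and distinguishes
    whether [l] is itself frequent enough, or one of the remaining letters has to
    be. *)

(** * Words over a finite alphabet and the agreement numbers *)

Section Arithmetic.
Local Open Scope nat_scope.

(** The initial value at [b = c = nu] agrees with the recursion, so inside the
    range [c <= nu <= b] only the recursion has to be considered. *)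
Lemma agreement_rec m b c nu : 0 < c -> c <= nu -> nu <= b ->
  agreement m.+2 b c nu
    = \sum_(0 <= s < c) 'C(b, s) * agreement m.+1 (b - s) c (nu - s)
    + \sum_(c <= s < nu.+1) 'C(b, s) * 'C(b - s, nu - s) * m ^ (nu - s).
Proof.
move=> c0 cnu nub; rewrite [LHS]/=.
rewrite ifN; last by lia.
case: andP => [[/eqP bc /eqP nuc]|_]; last by rewrite -[m.+2 - 2]/(m - 0) subn0.
subst b nu.
rewrite big_nat1 subnn expn0 !binn !muln1.
rewrite big_ltn // big_nat big1 ?addn0; last first.
  by move=> s /andP[s0 sc] /=; rewrite orbCA ifT ?muln0 //; apply/orP; left; lia.
rewrite bin0 !subn0 mul1n /=.
case: m => [|m] //.
by rewrite !ltnn !eqxx /=; lia.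
Qed.

(** Reconciles the natural range [j <= b] of a sum over subsets with the ranges
    cut off at the weight bound, whichever of the two is longer: beyond [b] the
    binomial vanishes. *)
Lemma sum_binomial_truncate (b m : nat) (G : nat -> nat) :
  (forall j, m <= j -> G j = 0) ->
  \sum_(0 <= j < b.+1) 'C(b, j) * G j = \sum_(0 <= j < m) 'C(b, j) * G j.
Proof.
move=> G0; set N := maxn b.+1 m.
rewrite [RHS](big_nat_widen _ _ N) ?leq_maxr // [LHS](big_nat_widen _ _ N) ?leq_maxl //.
rewrite [LHS]big_mkcond [RHS]big_mkcond /=; apply: eq_bigr => j _.
case: (ltnP j m) => jm; case: ltnP => jb //; first by rewrite bin_small.
by rewrite G0 // muln0.
Qed.

End Arithmetic.

Section Words.
Local Open Scope nat_scope.
Variables (I V : finType) (z : V).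
Implicit Types (D S : {set I}) (L : {set V}) (h : {ffun I -> V}).

(** Words over the alphabet [L] together with the zero letter [z], supported in
    [D].  Words are total on [I], so that all supports share one function type. *)
Definition words D L : {set {ffun I -> V}} :=
  [set h : {ffun I -> V} | [forall i, h i \in (if i \in D then z |: L else [set z])]].

Definition nonzero_at h : {set I} := [set i | h i != z].

(** Puts the letter [l] on [S]; it undoes the erasure of a letter. *)
Definition paint S l h : {ffun I -> V} := [ffun i => if i \in S then l else h i].

Lemma wordsP D L h :
  reflect (forall i, h i != z -> (i \in D) && (h i \in L)) (h \in words D L).
Proof.
rewrite inE; apply: (iffP forallP) => H i; have := H i.
  by case: ifP => _; rewrite !inE; case: eqP.
by case: ifP => _; rewrite !inE; case: eqP => //= _; apply.
Qed.

Lemma nonzero_at_words D L h : h \in words D L -> nonzero_at h \subset D.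
Proof.
by move/wordsP=> H; apply/subsetP=> i; rewrite inE => /H/andP[].
Qed.

Lemma sum_subsets_card (D : {set I}) (G : nat -> nat) :
  \sum_(S : {set I} | S \subset D) G #|S|
    = \sum_(0 <= j < #|D|.+1) 'C(#|D|, j) * G j.
Proof.
rewrite big_mkord (partition_big (fun S : {set I} => inord #|S| : 'I_#|D|.+1) xpredT) //.
apply: eq_bigr => j _; rewrite -cards_draws -sum_nat_cond_const.
have sizeE S : S \subset D -> (inord #|S| == j) = (#|S| == j).
  by move=> SD; rewrite -val_eqE /= inordK // ltnS subset_leq_card.
apply: eq_big => S; first by case SD: (S \subset D); rewrite //= sizeE.
by case/andP=> SD; rewrite sizeE // => /eqP->.
Qed.

(** A word with support exactly [S] is a free choice of a letter of [L] at each
    position of [S]. *)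
Lemma sum_words_nonzero_at D L (G : {set I} -> nat) : z \notin L ->
  \sum_(h in words D L) G (nonzero_at h)
    = \sum_(S : {set I} | S \subset D) #|L| ^ #|S| * G S.
Proof.
move=> zL; rewrite (partition_big nonzero_at (fun S : {set I} => S \subset D)); last first.
  by move=> h /nonzero_at_words.
apply: eq_bigr => S SD; rewrite -(card_pffun_on z (mem S) (mem L)).
rewrite (eq_bigr (fun=> G S)); last by move=> h /andP[_ /eqP->].
rewrite sum_nat_const; congr (_ * _); apply: eq_card => h.
apply/andP/pffun_onP.
  case=> /wordsP hW /eqP<-; split.
    by apply/supportP => i; rewrite inE negbK => /eqP.
  by move=> v /imageP[i]; rewrite inE => /hW /andP[_ ?] ->.
case=> /supportP hS hL.
have hz i : (h i != z) = (i \in S).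
  apply/idP/idP; first by apply: contraNT => /hS ->.
  move=> iS; apply: contraNneq zL => <-; apply: hL.
  by apply/imageP; exists i.
split; last by apply/eqP/setP=> i; rewrite inE hz.
apply/wordsP=> i; rewrite hz => iS; rewrite (subsetP SD) //=.
by apply: hL; apply/imageP; exists i.
Qed.

Lemma sum_words_weight D L (G : nat -> nat) : z \notin L ->
  \sum_(h in words D L) G #|nonzero_at h|
    = \sum_(0 <= j < #|D|.+1) 'C(#|D|, j) * (#|L| ^ j * G j).
Proof.
move=> zL; rewrite (sum_words_nonzero_at _ (fun S => G #|S|)) //.
exact: (sum_subsets_card D (fun j => #|L| ^ j * G j)).
Qed.

(** A word is determined by the set [S] where it takes the value [l] and by the
    word left when those entries are erased, which omits [l] and lives off [S].
    This is the step from [a] to [a - 1] in the recursion of the agreement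
    numbers. *)
Lemma sum_words_peel D L l (G : {ffun I -> V} -> nat) :
  l \notin L -> l != z ->
  \sum_(h in words D (l |: L)) G h
    = \sum_(S : {set I} | S \subset D) \sum_(h in words (D :\: S) L) G (paint S l h).
Proof.
move=> lL lz; rewrite pair_big_dep /=.
rewrite (reindex_onto (fun p => paint p.1 l p.2)
  (fun h : {ffun I -> V} => ([set i | h i == l], [ffun i => if h i == l then z else h i]))) /=.
  apply: eq_bigl => -[S h] /=; apply/andP/andP.
    case=> /wordsP hW /eqP[ES Eh].
    have hl i : i \in S -> h i = z.
      by move=> iS; rewrite -Eh !ffunE iS eqxx.
    split.
      apply/subsetP=> i iS; have := hW i; rewrite ffunE iS => /(_ lz).
      by case/andP.
    apply/wordsP=> i hi; have iS : i \notin S.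
      by apply: contraNN hi => /hl/eqP.
    have := hW i; rewrite ffunE (negPf iS) => /(_ hi)/andP[iD].
    rewrite !inE iS iD /= => /orP[/eqP hil|//].
    by move: iS; rewrite -ES inE ffunE -hil; case: ifP; rewrite eqxx.
  case=> SD /wordsP hW.
  have hS i : i \in S -> h i = z.
    move=> iS; apply/eqP; apply: contraTT iS => /hW /andP[].
    by rewrite inE => /andP[].
  have nl i : h i != l.
    case: (eqVneq (h i) z) => [->|/hW/andP[_]]; first by rewrite eq_sym.
    by apply: contraTneq => ->.
  split.
    apply/wordsP=> i; rewrite ffunE; case: ifP => iS.
      by move=> _; rewrite (subsetP SD) // !inE eqxx.
    by move/hW; rewrite !inE iS /= => /andP[-> ->]; rewrite orbT.
  rewrite xpair_eqE; apply/andP; split; apply/eqP.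
    by apply/setP=> i; rewrite inE ffunE; case: ifP; rewrite ?eqxx // (negPf (nl i)).
  apply/ffunP=> i; rewrite !ffunE; case: (boolP (i \in S)) => iS.
    by rewrite eqxx hS.
  by rewrite (negPf (nl i)).
by move=> h _; apply/ffunP=> i; rewrite !ffunE inE; case: eqP.
Qed.

Lemma card_nonzero_at_paint S l h : l != z -> [disjoint S & nonzero_at h] ->
  #|nonzero_at (paint S l h)| = #|S| + #|nonzero_at h|.
Proof.
move=> lz dis; rewrite -cardsUI (disjoint_setI0 dis) cards0 addn0.
congr #|pred_of_set _|; apply/setP=> i; rewrite !inE ffunE.
by case: (i \in S); rewrite ?lz.
Qed.

Lemma letter_count D L h l : l != z -> h \in words D L ->
  #|[set i | h i == l]| <= #|nonzero_at h| <= #|D|.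
Proof.
move=> lz hW; rewrite [X in _ && X](subset_leq_card (nonzero_at_words hW)) andbT.
by apply/subset_leq_card/subsetP=> i; rewrite !inE => /eqP->.
Qed.

(** Induction on the number of letters.  Fix a letter [l], occurring [s] times.
    If [s >= c] the condition on frequent letters holds, and the other entries
    are only counted by weight; if [s < c] some other letter is frequent in the
    remaining word of length [#|D| - s] and weight [nu - s]. *)
Lemma agreement_words m D L c nu : z \notin L -> #|L| = m -> 0 < c ->
  \sum_(h in words D L)
     ((#|nonzero_at h| == nu) && [exists l in L, c <= #|[set i | h i == l]|])
    = agreement m.+1 #|D| c nu.
Proof.
elim: m => [|m IH] in D L nu *; move=> zL Lm c0.
  have L0 : L = set0 by apply/eqP; rewrite -cards_eq0 Lm.
  rewrite big1 // => h _; apply/eqP; rewrite eqb0 negb_and; apply/orP; right.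
  by apply/exists_inPn => l; rewrite L0 inE.
have [bad|/norP[]] := boolP [|| #|D| < c, nu < c | #|D| < nu].
  rewrite /= bad big1 // => h hW.
  case: eqP => //= hnu; case: exists_inP => // -[l lL cl].
  have lz : l != z by apply: contraNneq zL => <-.
  by have := letter_count lz hW; rewrite hnu; lia.
rewrite -leqNgt => cD /norP[]; rewrite -!leqNgt => cnu nuD.
have [l lL] : exists l, l \in L by apply/card_gt0P; rewrite Lm.
have lz : l != z by apply: contraNneq zL => <-.
set L' := L :\ l.
have L'm : #|L'| = m by apply/eqP; rewrite -eqSS -Lm (cardsD1 l L) lL.
have zL' : z \notin L' by rewrite inE negb_and zL orbT.
have lL' : l \notin L' by rewrite !inE eqxx.
(* [G s] is the number of those among the counted words whose set of occurrences
   of [l] is a given set of size [s]. *)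
rewrite -(setD1K lL) -/L' sum_words_peel // agreement_rec //.
pose G s := if s < c then agreement m.+1 (#|D| - s) c (nu - s)
            else if s <= nu then 'C(#|D| - s, nu - s) * m ^ (nu - s) else 0.
transitivity (\sum_(S : {set I} | S \subset D) G #|S|).
  apply: eq_bigr => S SD.
  have cDS : #|D :\: S| = #|D| - #|S| by rewrite cardsD (setIidPr SD).
  have sD : #|S| <= #|D| by apply: subset_leq_card.
  have inner h : h \in words (D :\: S) L' ->
      (#|nonzero_at (paint S l h)| == nu)
        && [exists l0 in l |: L', c <= #|[set i | paint S l h i == l0]|]
      = (#|S| + #|nonzero_at h| == nu)
        && ((c <= #|S|) || [exists l0 in L', c <= #|[set i | h i == l0]|]).
    move=> hW; rewrite card_nonzero_at_paint //; last first.
      rewrite disjoints_subset; apply/subsetP=> i iS; rewrite inE.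
      apply: contraL iS => /(subsetP (nonzero_at_words hW)).
      by rewrite inE => /andP[].
    congr (_ && _).
    have hS i : i \in S -> h i = z.
      move=> iS; apply/eqP; apply: contraTT iS => /(wordsP _ _ _ hW) /andP[].
      by rewrite inE => /andP[].
    have setl : [set i | paint S l h i == l] = S.
      apply/setP=> i; rewrite inE ffunE; case: (boolP (i \in S)); first by rewrite eqxx.
      move=> _; apply/negbTE; case: (eqVneq (h i) z) => [->|]; first by rewrite eq_sym.
      by case/(wordsP _ _ _ hW)/andP=> _; apply: contraTneq => ->.
    have setl' l0 : l0 \in L' -> [set i | paint S l h i == l0] = [set i | h i == l0].
      move=> l0L; apply/setP=> i; rewrite !inE ffunE; case: (boolP (i \in S)) => // iS.
      rewrite hS // [RHS]eq_sym; move: l0L; rewrite !inE => /andP[ll0 l0L].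
      by rewrite eq_sym (negPf ll0); apply/esym/negbTE; apply: contraNneq zL => <-.
    apply/exists_inP/orP.
      case=> l0; rewrite in_setU1 => /predU1P[->|l0L]; first by rewrite setl; left.
      by rewrite setl' // => ?; right; apply/exists_inP; exists l0.
    case=> [Sc|/exists_inP[l0 l0L]].
      by exists l; rewrite ?setl // in_setU1 eqxx.
    by rewrite -setl' // => ?; exists l0; rewrite // in_setU1 l0L orbT.
  rewrite (eq_bigr _ (fun h hW => congr1 nat_of_bool (inner h hW))) /G.
  case: (ltnP #|S| c) => Sc.
    rewrite -cDS -(IH _ L') //; apply: eq_bigr => h _ /=.
    by congr (nat_of_bool (_ && _)); lia.
  case: (leqP #|S| nu) => Snu; last first.
    by rewrite big1 // => h _; rewrite gtn_eqF // (leq_trans Snu) ?leq_addr.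
  under eq_bigr => h _ do rewrite orTb andbT.
  rewrite (sum_words_weight _ (fun j => #|S| + j == nu)) // L'm cDS.
  rewrite big_mkord (bigD1 (inord (nu - #|S|))) //= big1 ?addn0; last first.
    move=> j; rewrite -val_eqE /= inordK => [/eqP jn|]; last by lia.
    by case: eqP; rewrite ?muln0 //; lia.
  rewrite inordK; last by lia.
  by rewrite subnKC // eqxx muln1.
rewrite sum_subsets_card (@big_cat_nat _ _ _ c) //=; last by lia.
congr (_ + _).
  by apply: eq_big_nat => s /andP[_ sc]; rewrite /G sc.
rewrite [LHS](@big_cat_nat _ _ _ nu.+1) //=; last by lia.
rewrite [X in _ + X]big_nat [X in _ + X]big1 ?addn0; last first.
  by move=> s /andP[s1 _]; rewrite /G !ifN ?muln0 //; lia.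
apply: eq_big_nat => s /andP[cs snu]; rewrite /G ifN -?leqNgt // ifT ?mulnA //.
Qed.

End Words.

(** * Vectors over a finite field with prescribed support *)

Section FieldWords.
Local Open Scope nat_scope.
Variables (I : finType) (F : finFieldType).
Implicit Types (A B S : {set I}) (f g h : {ffun I -> F}) (a : F).

Definition vectors A : {set {ffun I -> F}} := words 0%R A [set~ 0%R].
Definition weight f : nat := #|nonzero_at 0%R f|.

Lemma vectorsP A f : reflect (forall i, i \notin A -> f i = 0%R) (f \in vectors A).
Proof.
apply: (iffP (wordsP _ _ _ _)) => H i.
  by move=> iA; apply/eqP; apply: contraNT iA => /H/andP[].
by move=> fi; rewrite !inE fi andbT; apply: contraNT fi => /H->.
Qed.

Lemma card_nonzero_scalars : #|[set~ 0%R : F]| = #|F| - 1.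
Proof. by rewrite cardsC1 subn1. Qed.

Lemma nonzero_notin : 0%R \notin [set~ 0%R : F].
Proof. by rewrite !inE eqxx. Qed.

Lemma sum_vectors_weight A m (G : nat -> nat) : (forall j, m <= j -> G j = 0) ->
  \sum_(f in vectors A) G (weight f)
    = \sum_(0 <= j < m) 'C(#|A|, j) * (#|F| - 1) ^ j * G j.
Proof.
move=> G0; rewrite (sum_words_weight _ _ nonzero_notin) card_nonzero_scalars.
rewrite (@sum_binomial_truncate _ m); last by move=> j /G0->; rewrite muln0.
by apply: eq_bigr => j _; rewrite mulnA.
Qed.

Lemma weight_vectors A f : f \in vectors A -> weight f <= #|A|.
Proof. by move=> /nonzero_at_words/subset_leq_card. Qed.

Lemma card_vectors A : #|vectors A| = #|F| ^ #|A|.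
Proof.
rewrite -(card_pffun_on 0%R (mem A) predT); apply: eq_card => f.
apply/vectorsP/pffun_onP => [H|[/supportP H _]]; last exact: H.
by split=> // ; apply/supportP.
Qed.

(** Vectors supported in a disjoint union are sums of independent parts. *)
Lemma sum_vectors_split A B (G : {ffun I -> F} -> nat) : [disjoint A & B] ->
  \sum_(f in vectors (A :|: B)) G f
    = \sum_(g in vectors A) \sum_(h in vectors B) G (g + h)%R.
Proof.
move=> dis; have AB i : i \in A -> i \in B = false by apply: disjointFr.
rewrite pair_big /= (reindex_onto (fun p : {ffun I -> F} * {ffun I -> F} => (p.1 + p.2)%R)
  (fun f => ([ffun i => if i \in A then f i else 0%R],
             [ffun i => if i \in A then 0%R else f i]))) /=; last first.
  move=> f _; apply/ffunP=> i; rewrite !ffunE.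
  by case: ifP; rewrite ?addr0 ?add0r.
apply: eq_bigl => -[g h] /=; apply/andP/andP.
  case=> /vectorsP H /eqP[gE hE]; split; apply/vectorsP=> i iN.
    by rewrite -gE !ffunE (negPf iN).
  rewrite -hE !ffunE; case: ifP => // iA.
  by have := H i; rewrite !ffunE; apply; rewrite inE iA.
case=> /vectorsP gA /vectorsP hB; split.
  by apply/vectorsP=> i; rewrite inE negb_or => /andP[/gA gi /hB hi]; rewrite ffunE gi hi addr0.
rewrite xpair_eqE; apply/andP; split; apply/eqP/ffunP=> i; rewrite !ffunE.
  by case: ifPn => [/AB iB|/gA->//]; rewrite hB ?iB // addr0.
by case: ifPn => [/AB iB|/gA->]; rewrite ?add0r // hB ?iB.
Qed.

Definition sub_multiple a f g : {ffun I -> F} := (f - [ffun i => a * g i])%R.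

(** The condition on [f] and [g] for the plane with echelon rows [e_i + f] and
    [e_k + g] to have a nonzero vector of weight at most [d]; the pivots add one
    to the weight of a row, and two to that of a proper combination. *)
Definition low_pair d f g :=
  [|| weight g < d, weight f < d
    | [exists a : F, (a != 0%R) && ((weight (sub_multiple a f g)).+2 <= d)]].

Lemma weightD g h : [disjoint nonzero_at 0%R g & nonzero_at 0%R h] ->
  weight (g + h)%R = weight g + weight h.
Proof.
move=> dis; rewrite /weight -cardsUI (disjoint_setI0 dis) cards0 addn0.
apply: eq_card => i; rewrite !inE ffunE.
have := disjointFr dis (x := i); rewrite !inE.
case: (eqVneq (g i) 0%R) => [->|gi /(_ isT)/negbFE/eqP->]; first by rewrite add0r.
by rewrite addr0 gi.
Qed.

(** Restricted to the support of [f], because off it [h] and [f] both vanish and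
    always agree. *)
Definition agreements a h f := #|[set i in nonzero_at 0%R f | h i == (a * f i)%R]|.

Lemma weight_sub_multiple a f h : h \in vectors (nonzero_at 0%R f) ->
  weight (sub_multiple a h f) = weight f - agreements a h f.
Proof.
move/vectorsP=> hS; rewrite /weight /agreements.
set E := [set i in _ | _]; have ES : E \subset nonzero_at 0%R f.
  by apply/subsetP=> i; rewrite inE => /andP[].
rewrite -(setIidPr ES) -cardsD; apply: eq_card => i.
rewrite !inE !ffunE subr_eq0; case: (boolP (f i == 0%R)) => /= [fi|fi]; last by rewrite andbT.
by rewrite hS ?inE ?negbK // (eqP fi) mulr0 eqxx.
Qed.

(** Dividing [h] by [f] on the support of [f] turns agreement with [a f] into
    occurrences of the letter [a]. *)
Lemma agreement_vectors f c nu : 0 < c ->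
  \sum_(h in vectors (nonzero_at 0%R f))
     ((weight h == nu) && [exists a : F, (a != 0%R) && (c <= agreements a h f)])
    = agreement #|F| (weight f) c nu.
Proof.
move=> c0; have F1 : (#|F| - 1).+1 = #|F|.
  by rewrite subn1 prednK //; apply/card_gt0P; exists 0%R.
rewrite -F1 -(agreement_words _ _ nonzero_notin card_nonzero_scalars c0).
rewrite (reindex_onto (fun x : {ffun I -> F} => [ffun i => x i * f i]%R)
                      (fun h : {ffun I -> F} => [ffun i => h i / f i]%R)); last first.
  move=> h /vectorsP hS; apply/ffunP=> i; rewrite !ffunE.
  case: (boolP (f i == 0%R)) => fi; last by rewrite divfK.
  by rewrite hS ?inE ?negbK // !mul0r.
apply: eq_big => [x|x].
  apply/andP/vectorsP => [[/vectorsP H /eqP E] i iN|H].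
    by rewrite -E !ffunE; move: iN; rewrite inE negbK => /eqP->; rewrite invr0 mulr0.
  split; first by apply/vectorsP=> i iN; rewrite ffunE H // mul0r.
  apply/eqP/ffunP=> i; rewrite !ffunE; case: (boolP (f i == 0%R)) => fi; last by rewrite mulfK.
  by rewrite H ?inE ?negbK // !mul0r.
case/andP=> _ /eqP E.
have fx i : x i != 0%R -> f i != 0%R.
  by apply: contraNneq; rewrite -E !ffunE => ->; rewrite invr0 mulr0.
have nE : nonzero_at 0%R [ffun i => x i * f i]%R = nonzero_at 0%R x.
  apply/setP=> i; rewrite !inE ffunE mulf_eq0 negb_or.
  by case: (boolP (x i == 0%R)) => //= /fx ->.
rewrite /weight nE; congr (nat_of_bool (_ && _)); apply: eq_existsb => a.
rewrite !inE /agreements; case: eqP => //= /eqP a0; congr (c <= _).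
apply: eq_card=> i; rewrite !inE ffunE; case: (boolP (f i == 0%R)) => fi /=.
  apply/esym/negbTE; have: x i == 0%R by apply: contraLR fi; exact: fx.
  by move/eqP->; rewrite eq_sym.
by rewrite (inj_eq (mulIf fi)).
Qed.

(** Write a vector supported in [A] as a part of weight [t] off the support of
    [f] plus a part [h] on it.  Subtracting [a f] from it leaves weight
    [t + (weight f - agreements a h f)], so lightness asks for at least
    [weight f - d + t + 2] agreements, which is possible only for [t <= d - 2];
    heaviness asks for [weight h >= d - t]. *)
Lemma sum_heavy_light A f d : nonzero_at 0%R f \subset A -> 2 <= d <= weight f ->
  \sum_(h in vectors A)
     ((d <= weight h) && [exists a : F, (a != 0%R) && ((weight (sub_multiple a h f)).+2 <= d)])
  = \sum_(0 <= t < d - 1) 'C(#|A| - weight f, t) * (#|F| - 1) ^ t *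
      \sum_(d - t <= nu < (weight f).+1) agreement #|F| (weight f) (weight f - d + t + 2) nu.
Proof.
move=> SA /andP[d2 ds]; set S := nonzero_at 0%R f in SA *.
have dis : [disjoint A :\: S & S] by rewrite disjoints_subset subsetDr.
have AE : (A :\: S) :|: S = A by rewrite setUC -{1}(setIidPr SA) setID.
rewrite -{1}AE sum_vectors_split //.
pose G t := if t < d - 1 then
  \sum_(d - t <= nu < (weight f).+1) agreement #|F| (weight f) (weight f - d + t + 2) nu else 0.
transitivity (\sum_(g in vectors (A :\: S)) G (weight g)); last first.
  rewrite (sum_vectors_weight _ (m := d - 1)); last by move=> j; rewrite /G ltnNge => ->.
  rewrite cardsD (setIidPr SA); apply: eq_big_nat => t /andP[_ td].
  by rewrite /G td.
apply: eq_bigr => g gD; set t := weight g.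
have dgh h : h \in vectors S -> [disjoint nonzero_at 0%R g & nonzero_at 0%R h].
  move=> hS; apply: disjointWl (nonzero_at_words gD) _.
  by apply: disjointWr (nonzero_at_words hS) _.
have dS a h : h \in vectors S -> sub_multiple a h f \in vectors S.
  move=> /vectorsP hS; apply/vectorsP=> i iS; rewrite !ffunE hS //.
  by move: iS; rewrite inE negbK => /eqP->; rewrite mulr0 subr0.
have E h : h \in vectors S ->
  (d <= weight (g + h)%R)
     && [exists a : F, (a != 0%R) && ((weight (sub_multiple a (g + h)%R f)).+2 <= d)]
  = (d <= t + weight h)
     && [exists a : F, (a != 0%R) && (t + (weight f - agreements a h f) + 2 <= d)].
  move=> hS; rewrite weightD ?dgh //; congr (_ && _); apply: eq_existsb => a.
  congr (_ && _); rewrite /sub_multiple -addrA weightD ?dgh ?dS //.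
  by rewrite weight_sub_multiple // addn2.
rewrite (eq_bigr _ (fun h hS => congr1 nat_of_bool (E h hS))) /G.
case: (ltnP t (d - 1)) => td; last first.
  rewrite big1 // => h _; case: existsP => [[a /andP[_]]|]; last by rewrite andbF.
  by lia.
under [RHS]eq_bigr => nu _ do rewrite -agreement_vectors ?addn_gt0 ?orbT //.
rewrite exchange_big /=; apply: eq_bigr => h hS.
have -> : [exists a : F, (a != 0%R) && (t + (weight f - agreements a h f) + 2 <= d)]
   = [exists a : F, (a != 0%R) && (weight f - d + t + 2 <= agreements a h f)].
  apply: eq_existsb => a; congr (_ && _).
  have : agreements a h f <= weight f by apply/subset_leq_card/subsetP => i; rewrite inE => /andP[].
  by lia.
have whS : weight h <= weight f := weight_vectors hS.
case: [exists a, _]; last by rewrite andbF big1 // => nu _; rewrite andbF.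
case: (leqP d (t + weight h)) => dh.
  rewrite (bigD1_seq (weight h)) ?iota_uniq ?mem_index_iota //=; last by lia.
  rewrite eqxx big1 // => nu; rewrite eq_sym andbT => /negPf.
  by rewrite eq_sym => ->.
by rewrite big_nat big1 // => nu /andP[nu1 _]; rewrite andbT; case: eqP => //; lia.
Qed.

(** For a fixed [g], the number of suitable [f] depends only on the weight of
    [g]: all of them are suitable if [g] is light; otherwise either [f] is light,
    or both are heavy and [sum_heavy_light] applies. *)
Lemma sum_low_pair A B d : B \subset A -> 2 <= d ->
  \sum_(g in vectors B) \sum_(f in vectors A) low_pair d f g
  = #|F| ^ #|A| * (\sum_(0 <= j < d) 'C(#|B|, j) * (#|F| - 1) ^ j)
    + \sum_(d <= j < #|B|.+1) \sum_(0 <= h < d)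
        'C(#|B|, j) * 'C(#|A|, h) * (#|F| - 1) ^ (j + h)
    + \sum_(d <= s < #|B|.+1) \sum_(0 <= t < d - 1)
        'C(#|B|, s) * 'C(#|A| - s, t) * (#|F| - 1) ^ (s + t)
        * (\sum_(d - t <= nu < s.+1) agreement #|F| s (s - d + t + 2) nu).
Proof.
move=> BA d2.
(* [G1] counts [f] against a light [g], [G2] against a heavy one.  The cut-off at
   [#|B|] below records that no [g] is heavier than that. *)
pose G1 s := if s < d then #|F| ^ #|A| else 0.
pose G2 s := \sum_(0 <= h < d) 'C(#|A|, h) * (#|F| - 1) ^ h
  + \sum_(0 <= t < d - 1) 'C(#|A| - s, t) * (#|F| - 1) ^ t
      * (\sum_(d - t <= nu < s.+1) agreement #|F| s (s - d + t + 2) nu).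
transitivity (\sum_(g in vectors B)
  (G1 (weight g) + if weight g < d then 0
                   else if weight g <= #|B| then G2 (weight g) else 0)).
  apply: eq_bigr => g gB; rewrite /low_pair /G1; case: ltnP => gd /=.
    by rewrite addn0 sum1_card card_vectors.
  rewrite add0n weight_vectors // /G2 -sum_heavy_light ?d2 //; last first.
    by apply: subset_trans BA; apply: nonzero_at_words gB.
  have -> : \sum_(0 <= h < d) 'C(#|A|, h) * (#|F| - 1) ^ h
      = \sum_(f in vectors A) (weight f < d).
    rewrite (@sum_vectors_weight _ d (fun j => j < d)); last first.
      by move=> j; rewrite leqNgt => /negPf->.
    by apply: eq_big_nat => j /andP[_ jd]; rewrite jd muln1.
  rewrite -big_split; apply: eq_bigr => f _ /=; rewrite (leqNgt d).
  by case: (_ < d).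
rewrite -addnA big_split /=; congr (_ + _).
  rewrite (@sum_vectors_weight _ d); last by move=> j; rewrite /G1 ltnNge => ->.
  rewrite big_distrr /=; apply: eq_big_nat => j /andP[_ jd].
  by rewrite /G1 jd mulnC.
rewrite (@sum_vectors_weight _ #|B|.+1
  (fun j => if j < d then 0 else if j <= #|B| then G2 j else 0)); last first.
  by move=> j jB; rewrite (leqNgt j) jB; case: ifP.
rewrite -big_split [RHS](big_nat_widenl _ 0) // [RHS]big_mkcond /=.
apply: eq_big_nat => s /andP[_ sB]; rewrite ltnS in sB; rewrite sB.
case: (ltnP s d) => _ /=; first by rewrite muln0.
rewrite /G2 mulnDr 2!big_distrr /=; congr (_ + _); apply: eq_bigr => t _.
  by rewrite expnD; ring.
by rewrite expnD; ring.
Qed.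

End FieldWords.

(** * Lines, planes and the Moebius function *)

Section Planes.
Variables (F : finFieldType) (vT : vectType F).
Implicit Types (u v w : vT) (U V L : {vspace vT}).

Lemma dim_plane u v : u != 0 -> v \notin <[u]>%VS -> \dim (<[u]> + <[v]>) = 2%N.
Proof.
move=> u0 vu; have v0 : v != 0 by apply: contraNneq vu => ->; apply: mem0v.
have le2 : (\dim (<[u]> + <[v]>) <= 2)%N.
  by rewrite (leq_trans (dimv_add_leqif _ _)) // !dim_vline u0 v0.
apply/eqP; rewrite eqn_leq le2 ltnNge; apply: contra vu => le1.
have/eqP -> : <[u]>%VS == (<[u]> + <[v]>)%VS by rewrite eqEdim addvSl dim_vline u0.
by rewrite (subvP (addvSr _ _)) // memv_line.
Qed.

Lemma plane_eq U u v : \dim U = 2%N -> u \in U -> v \in U ->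
  u != 0 -> v \notin <[u]>%VS -> U = (<[u]> + <[v]>)%VS.
Proof.
move=> dU uU vU u0 vu; apply/esym/eqP; rewrite eqEdim dU dim_plane // leqnn andbT.
by rewrite subv_add -!memvE uU.
Qed.

Lemma line_eq L u : \dim L = 1%N -> u \in L -> u != 0 -> L = <[u]>%VS.
Proof.
move=> dL uL u0; apply/esym/eqP; rewrite eqEdim dL dim_vline u0 andbT.
by rewrite -memvE.
Qed.

Lemma mem_vline_scale u v : v != 0 -> v \in <[u]>%VS -> u \in <[v]>%VS.
Proof.
move=> v0 /vlineP[k vE]; apply/vlineP; exists k^-1.
have k0 : k != 0 by apply: contraNneq v0 => k0; rewrite vE k0 scale0r.
by rewrite vE scalerA mulVf ?scale1r.
Qed.

Lemma mem_plane u v x : reflect (exists a b, x = a *: u + b *: v) (x \in (<[u]> + <[v]>)%VS).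
Proof.
apply: (iffP memv_addP) => [[y /vlineP[a ->] [z /vlineP[b ->] ->]]|[a [b ->]]].
  by exists a, b.
exists (a *: u); first by rewrite memvZ ?memv_line.
by exists (b *: v); rewrite ?memvZ ?memv_line.
Qed.

End Planes.

Section Rows.
Variables (F : finFieldType) (n : nat).
Local Notation vT := 'rV[F]_n.
Local Notation q := #|F|.
Implicit Types (u v w : vT) (U V L : {vspace vT}).

Lemma card_space V : #|V| = (q ^ \dim V)%N.
Proof. exact: (card_vspace V). Qed.

(** Count the vectors [w] outside the line of [v]: each spans one plane with [v],
    and each plane through [v] has [q ^ 2 - q] of them. *)
Lemma card_planes_through v : v != 0 ->
  (#|[set V : {vspace vT} | (\dim V == 2) && (v \in V)]| * (q ^ 2 - q) = q ^ n - q)%N.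
Proof.
move=> v0; have cl : #|<[v]>%VS| = q by rewrite card_space dim_vline v0 expn1.
transitivity (\sum_(V : {vspace vT} | (\dim V == 2%N) && (v \in V))
   \sum_(w | (w \in V) && (w \notin <[v]>%VS)) 1)%N.
  rewrite -sum_nat_cond_const; apply: eq_bigr => V /andP[/eqP dV vV].
  rewrite sum1_card -dV -card_space -cl -(cardID (mem <[v]>%VS) (mem V)).
  rewrite (@eq_card _ [predI mem V & mem <[v]>%VS] (mem <[v]>%VS)).
    by rewrite addKn; apply: eq_card => w; rewrite !inE andbC.
  move=> w; rewrite !inE; apply: andb_idl; apply: subvP.
  by rewrite -memvE.
rewrite (exchange_big_dep (fun w => w \notin <[v]>%VS)) /=; last first.
  by move=> V w _ /andP[].
rewrite (eq_bigr (fun=> 1%N)).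
  rewrite sum1_card; have := cardID (mem <[v]>%VS) (mem (fullv : {vspace vT})).
  rewrite card_space dimvf /dim /= mul1n => <-.
  rewrite (@eq_card _ [predI mem fullv & mem <[v]>%VS] (mem <[v]>%VS)) ?cl; last first.
    by move=> w; rewrite !inE memvf.
  by rewrite addKn; apply: eq_card => w; rewrite !inE memvf andbT.
move=> w wv; rewrite (big_pred1 (<[v]> + <[w]>)%VS) // => V /=.
apply/andP/eqP => [[/andP[/eqP dV vV] /andP[wV _]]|->].
  exact: plane_eq.
rewrite dim_plane // eqxx wv andbT /=.
by rewrite (subvP (addvSl _ _)) ?memv_line // (subvP (addvSr _ _)) ?memv_line.
Qed.

Variable d : nat.

Definition low_vector v := (v != 0) && (hamming_weight v <= d)%N.

Lemma hamming_weightZ a v : a != 0 -> hamming_weight (a *: v) = hamming_weight v.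
Proof.
move=> a0; apply: eq_card => i; rewrite !inE mxE mulf_eq0 (negPf a0); exact: erefl.
Qed.

Lemma low_line v : low_vector v -> low_weight_space d <[v]>%VS.
Proof.
case/andP=> v0 wv; apply/orP; right; apply/existsP.
have d1 : \dim <[v]>%VS == 1%N by rewrite dim_vline v0.
rewrite (eqP d1); exists [tuple v]; rewrite /= wv andbT basisEdim.
by rewrite span_seq1 subvv dim_vline v0.
Qed.

(** Proportional vectors have the same weight, so on a low line every nonzero
    vector is low. *)
Lemma low_lineP L v : \dim L = 1%N -> low_weight_space d L -> v \in L -> v != 0 -> low_vector v.
Proof.
move=> dL; rewrite /low_weight_space -dimv_eq0 dL /= => /existsP[X].
case/andP=> bX; case: X bX => -[|x [|//]] sX; rewrite ?dL // => bX.
rewrite /= andbT => wx vL v0; rewrite /low_vector v0.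
have: v \in <[x]>%VS by rewrite -span_seq1 (span_basis bX).
case/vlineP=> k vE; rewrite vE hamming_weightZ //.
by apply: contraNneq v0 => k0; rewrite vE k0 scale0r.
Qed.

Definition low_lines V : {set dowling F n d} :=
  [set L : dowling F n d | (\dim L == 1%N) && (L <= V)%VS].

(** The low vectors of [V] are partitioned by the lines that they span, each
    with [q - 1] nonzero vectors. *)
Lemma card_low_lines V : (#|low_lines V| * (q - 1) = #|[set v in V | low_vector v]|)%N.
Proof.
rewrite -sum_nat_const -sum1_card.
pose line v : dowling F n d := insubd (dowling0 F n d) <[v]>%VS.
have lineE v : low_vector v -> line v = <[v]>%VS :> {vspace vT}.
  by move=> lv; rewrite /line val_insubd low_line.
rewrite [RHS](partition_big line (mem (low_lines V))).
  apply: eq_bigr => L; rewrite inE => /andP[/eqP dL LV].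
  have cL : #|(L : {vspace vT})| = q by rewrite card_space dL expn1.
  rewrite sum1_card -cL (cardD1 0 (L : {vspace vT})) mem0v addKn.
  apply: eq_card => v; rewrite !inE; apply/andP/andP => [[v0 vL]|].
    have lv : low_vector v by apply: low_lineP vL v0 => //; exact: (valP L).
    split; first by rewrite inE (subvP LV _ vL).
    by apply/eqP/val_inj; rewrite /= lineE // -(line_eq dL vL v0).
  case; rewrite inE => /andP[vV lv] /eqP <-; rewrite lineE // memv_line.
  by case/andP: lv.
move=> v; rewrite !inE => /andP[vV lv]; rewrite lineE // -memvE vV andbT.
by rewrite dim_vline; case/andP: lv => ->.
Qed.

Lemma mobius_line (L : dowling F n d) : \dim L = 1%N ->
  mobius (dowling0 F n d) L = -1.
Proof.
move=> dL; rewrite mobiusE.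
have L0 : (dowling0 F n d == L) = false.
  by apply/negbTE; apply: contra_eqN dL => /eqP<-; rewrite dimv0.
have leL (M : dowling F n d) : (dowling0 F n d <= M)%O by apply: sub0v.
rewrite L0 lt_neqAle L0 leL /= (big_pred1 (dowling0 F n d)); first by rewrite mobiusE eqxx.
move=> M; rewrite leL /=; apply/idP/eqP => [|->]; last by rewrite lt_neqAle L0 leL.
rewrite lt_neqAle => /andP[ML leML]; apply/val_inj/eqP; rewrite /= -dimv_eq0 -leqn0 -ltnS.
suff : (\dim M < \dim L)%N by rewrite dL.
rewrite ltn_neqAle dimvS // andbT; apply: contraNneq ML => dM.
by apply/eqP/val_inj/eqP; rewrite /= eqEdim dM leqnn andbT.
Qed.

Lemma mobius_plane (U : dowling F n d) : \dim U = 2%N ->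
  mobius (dowling0 F n d) U = #|low_lines U|%:R - 1.
Proof.
move=> dU; rewrite mobiusE.
have U0 : (dowling0 F n d == U) = false.
  by apply/negbTE; apply: contra_eqN dU => /eqP<-; rewrite dimv0.
have leU (M : dowling F n d) : (dowling0 F n d <= M)%O by apply: sub0v.
rewrite U0 lt_neqAle U0 leU /= (bigD1 (dowling0 F n d)); last first.
  by rewrite /= lt_neqAle U0 !leU.
rewrite /= [X in X + _]mobiusE eqxx opprD addrC; congr (_ - 1).
rewrite (eq_bigl (fun L : dowling F n d => L \in low_lines U)).
  rewrite (eq_bigr (fun=> -1)); last first.
    by move=> L; rewrite inE => /andP[/eqP dL _]; apply: mobius_line.
  by rewrite sumr_const mulNrn opprK.
move=> L; rewrite leU inE lt_neqAle /=; apply/idP/idP.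
  case/andP=> /andP[LU leLU L0]; rewrite [(L <= U)%VS]leLU andbT eqn_leq lt0n dimv_eq0.
  apply/andP; split; last by apply: contraNN L0 => /eqP L0; apply/eqP/val_inj.
  suff : (\dim L < \dim U)%N by rewrite dU.
  rewrite ltn_neqAle dimvS // andbT; apply: contraNneq LU => dLU.
  by apply/eqP/val_inj/eqP; rewrite /= eqEdim dLU leqnn andbT.
case/andP=> dL LU; rewrite -andbA; apply/and3P; split=> //.
  by apply: contraTneq dL => ->; rewrite dU.
by apply: contraTneq dL => ->; rewrite dimv0.
Qed.

Lemma low_plane_lines V : \dim V = 2%N -> low_weight_space d V ->
  (0 < #|low_lines V|)%N.
Proof.
move=> dV; rewrite /low_weight_space -dimv_eq0 dV /= => /existsP[X].
case/andP=> bX; case: X bX => -[|x X] sX; rewrite ?dV // => bX /= /andP[wx _].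
have lx : low_vector x.
  by rewrite /low_vector wx andbT; have /free_not0 := basis_free bX; apply; rewrite inE eqxx.
suff : (0 < #|low_lines V| * (q - 1))%N by rewrite muln_gt0 => /andP[].
rewrite card_low_lines; apply/card_gt0P; exists x; rewrite inE lx andbT.
by apply: (basis_mem bX); rewrite inE eqxx.
Qed.

(** Low vectors on two distinct lines of a plane form a low-weight basis. *)
Lemma low_lines_plane V : \dim V = 2%N -> (1 < #|low_lines V|)%N ->
  low_weight_space d V.
Proof.
move=> dV /card_gt1P[L1 [L2 []]]; rewrite !inE => /andP[/eqP d1 s1] /andP[/eqP d2 s2] ne.
have nz L : \dim L = 1%N -> exists2 v, v \in L & v != 0.
  by move=> dL; exists (vpick L); rewrite ?memv_pick // vpick0 -dimv_eq0 dL.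
have [v1 v1L v10] := nz _ d1; have [v2 v2L v20] := nz _ d2.
have l1 : low_vector v1 by apply: low_lineP v1L v10 => //; exact: (valP L1).
have l2 : low_vector v2 by apply: low_lineP v2L v20 => //; exact: (valP L2).
have v21 : v2 \notin <[v1]>%VS.
  rewrite -(line_eq d1 v1L v10); apply: contraNN ne => v2L1.
  by apply/eqP/val_inj; rewrite /= (line_eq d2 v2L v20) (line_eq d1 v2L1 v20).
apply/orP; right; apply/existsP; rewrite dV; exists [tuple v1; v2].
have VE := plane_eq dV (subvP s1 _ v1L) (subvP s2 _ v2L) v10 v21.
case/andP: l1 l2 => _ w1 /andP[_ w2]; rewrite /= w1 w2 !andbT basisEdim dV leqnn andbT.
by rewrite span_cons span_seq1 -VE subvv.
Qed.

(** A plane outside the lattice has at most one low line, and then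
    [a - (a > 0)] is zero, so the sum may run over all planes. *)
Lemma whitney2E :
  whitney F n d 2
    = \sum_(V : {vspace vT} | \dim V == 2%N) (#|low_lines V|%:R - (0 < #|low_lines V|)%N%:R).
Proof.
rewrite (bigID (low_weight_space d)) /= [X in _ + X]big1 ?addr0; last first.
  move=> V /andP[/eqP dV /negP nl]; have: (#|low_lines V| <= 1)%N.
    by rewrite leqNgt; apply/negP => /(low_lines_plane dV).
  by case: #|_| => [|[|]] //; rewrite subrr.
rewrite (reindex_onto (@dowling_val F n d) (insubd (dowling0 F n d))) /=; last first.
  by move=> V /andP[_ lV]; rewrite -[LHS]/(val _) insubdK.
apply: eq_big => U.
  by rewrite (valP U) valKd eqxx !andbT.
by move/eqP=> dU; rewrite mobius_plane // low_plane_lines //; apply: (valP U).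
Qed.

(** Double counting of the incidences between low vectors and planes; the
    factors [q - 1] and [q ^ 2 - q] are kept on the left to avoid division. *)
Lemma sum_low_lines :
  ((\sum_(V : {vspace vT} | \dim V == 2) #|low_lines V|) * (q - 1) * (q ^ 2 - q)
    = #|[set v | low_vector v]| * (q ^ n - q))%N.
Proof.
rewrite !big_distrl /=.
transitivity (\sum_(V : {vspace vT} | \dim V == 2%N)
  \sum_(v | (v \in V) && low_vector v) (q ^ 2 - q))%N.
  apply: eq_bigr => V _; rewrite card_low_lines sum_nat_const; congr (_ * _)%N.
  by apply: eq_card => v; rewrite !inE.
rewrite (exchange_big_dep low_vector) /=; last by move=> V v _ /andP[].
rewrite -sum_nat_const; apply: eq_big => v; first by rewrite inE.
move=> lv; rewrite -(card_planes_through (proj1 (andP lv))) -sum_nat_const.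
by apply: eq_bigl => V; rewrite inE lv andbT.
Qed.

Definition row_of (f : {ffun 'I_n -> F}) : vT := \row_j f j.

Lemma row_of_bij : bijective row_of.
Proof.
exists (fun v => [ffun j => v 0 j]) => [f|v]; first by apply/ffunP=> j; rewrite ffunE mxE.
by apply/rowP=> j; rewrite mxE ffunE.
Qed.

Lemma hamming_weight_row f : hamming_weight (row_of f) = weight f.
Proof. by apply: eq_card => j; rewrite !inE mxE. Qed.

Lemma weight_eq0 (f : {ffun 'I_n -> F}) : (weight f == 0%N) = (row_of f == 0).
Proof.
rewrite cards_eq0; apply/eqP/eqP => [f0|/rowP f0].
  by apply/rowP=> j; have := in_set0 j; rewrite -f0 inE !mxE => /negbFE/eqP.
by apply/setP=> j; rewrite !inE; have := f0 j; rewrite !mxE => ->; rewrite eqxx.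
Qed.

Lemma card_low_vectors :
  (#|[set v | low_vector v]| = \sum_(1 <= j < d.+1) 'C(n, j) * (q - 1) ^ j)%N.
Proof.
rewrite -sum1dep_card (reindex row_of) /=; last exact: onW_bij row_of_bij.
transitivity (\sum_(f in vectors F [set: 'I_n]) (0 < weight f <= d))%N.
  rewrite big_mkcond /=; apply: eq_big => f.
    by apply/esym/vectorsP=> i; rewrite inE.
  move=> _; rewrite /low_vector hamming_weight_row -weight_eq0 lt0n.
  by case: (_ && _).
rewrite (@sum_vectors_weight _ _ _ d.+1 (fun j => 0 < j <= d)%N); last first.
  by move=> j; rewrite ltnNge => /negPf ->; rewrite andbF.
rewrite big_ltn // muln0 add0n cardsT card_ord; apply: eq_big_nat => j /andP[j0 jd].
by rewrite j0 -ltnS jd muln1.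
Qed.

End Rows.

(** * Reduced row echelon bases of planes *)

Section Echelon.
Variables (F : finFieldType) (n : nat).
Local Notation vT := 'rV[F]_n.
Local Notation q := #|F|.
Local Notation word := {ffun 'I_n -> F}.
Implicit Types (u v w : vT) (V : {vspace vT}) (f g : word) (i k : 'I_n).

(** The positions where a row of an echelon basis with pivots [i < k] is
    unconstrained. *)
Definition first_free i k : {set 'I_n} := [set j : 'I_n | (i < j)%N && (j != k)].
Definition second_free k : {set 'I_n} := [set j : 'I_n | (k < j)%N].

Definition pivot_row i f : vT := \row_j (f j + (j == i)%:R).

Lemma lincombE a b u v j : (a *: u + b *: v) 0 j = a * u 0 j + b * v 0 j.
Proof. by rewrite !mxE. Qed.

Definition plane_of i k f g : {vspace vT} := (<[pivot_row i f]> + <[pivot_row k g]>)%VS.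

(** The rows are encoded by their free parts [f] and [g]: the entries at and
    before the pivots are imposed by [pivot_row], so that vectors with prescribed
    support can be counted freely. *)
Record echelon i k f g : Prop := Echelon {
  ech_lt : (i < k)%N;
  ech_first : f \in vectors F (first_free i k);
  ech_second : g \in vectors F (second_free k) }.

Section PivotCoordinates.
Variables (i k : 'I_n) (f g : word).
Hypothesis E : echelon i k f g.

Lemma first_at_first : pivot_row i f 0 i = 1.
Proof. by rewrite mxE eqxx (vectorsP _ _ (ech_first E)) ?add0r // inE ltnn. Qed.

Lemma first_at_second : pivot_row i f 0 k = 0.
Proof.
rewrite mxE (vectorsP _ _ (ech_first E)) ?inE ?eqxx ?andbF //.
by rewrite -val_eqE gtn_eqF ?(ech_lt E) // addr0.
Qed.

Lemma first_before (j : 'I_n) : (j < i)%N -> pivot_row i f 0 j = 0.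
Proof.
move=> ji; rewrite mxE (vectorsP _ _ (ech_first E)) ?inE ?ltnNge ?(ltnW ji) //.
by rewrite -val_eqE ltn_eqF // addr0.
Qed.

Lemma second_at_second : pivot_row k g 0 k = 1.
Proof. by rewrite mxE eqxx (vectorsP _ _ (ech_second E)) ?add0r // inE ltnn. Qed.

Lemma second_before (j : 'I_n) : (j < k)%N -> pivot_row k g 0 j = 0.
Proof.
move=> ji; rewrite mxE (vectorsP _ _ (ech_second E)) ?inE ?ltnNge ?(ltnW ji) //.
by rewrite -val_eqE ltn_eqF // addr0.
Qed.

(** The entries at the pivots are coordinates in the echelon basis. *)
Lemma plane_coord w : w \in plane_of i k f g ->
  w = w 0 i *: pivot_row i f + w 0 k *: pivot_row k g.
Proof.
case/mem_plane=> a [b ->].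
rewrite !lincombE first_at_first first_at_second second_at_second.
by rewrite (second_before (ech_lt E)) !mulr1 !mulr0 addr0 add0r.
Qed.

Lemma first_neq0 : pivot_row i f != 0.
Proof.
apply/eqP=> u0; have := first_at_first; rewrite u0 mxE => /eqP.
by rewrite eq_sym oner_eq0.
Qed.

Lemma second_notin : pivot_row k g \notin <[pivot_row i f]>%VS.
Proof.
apply/negP=> /vlineP[a ga]; have := second_at_second.
by rewrite ga mxE first_at_second mulr0 => /eqP; rewrite eq_sym oner_eq0.
Qed.

Lemma dim_plane_of : \dim (plane_of i k f g) = 2%N.
Proof. exact: dim_plane first_neq0 second_notin. Qed.

Lemma first_in : pivot_row i f \in plane_of i k f g.
Proof. by rewrite (subvP (addvSl _ _)) ?memv_line. Qed.

Lemma second_in : pivot_row k g \in plane_of i k f g.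
Proof. by rewrite (subvP (addvSr _ _)) ?memv_line. Qed.

End PivotCoordinates.

(** A plane determines its first pivot as the first position where some vector
    of it is nonzero, and its second pivot likewise among its vectors vanishing
    at the first one; the entries at the pivots then fix the rows, by
    [plane_coord]. *)
Lemma echelon_inj i k f g i' k' f' g' :
  echelon i k f g -> echelon i' k' f' g' ->
  plane_of i k f g = plane_of i' k' f' g' ->
  ((i, k), (f, g)) = ((i', k'), (f', g')).
Proof.
have le1 j1 j2 l1 l2 f1 f2 g1 g2 : echelon j1 l1 f1 g1 -> echelon j2 l2 f2 g2 ->
    plane_of j1 l1 f1 g1 = plane_of j2 l2 f2 g2 -> (j1 <= j2)%N.
  move=> E1 E2 EP; rewrite leqNgt; apply/negP=> lt.
  have := first_in j2 l2 f2 g2; rewrite -EP => /(plane_coord E1)/rowP/(_ j2)/eqP.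
  rewrite lincombE (first_before E1) //.
  rewrite (second_before E1) ?(ltn_trans lt) ?(ech_lt E1) // !mulr0 addr0.
  by rewrite (first_at_first E2) oner_eq0.
have le2 j l1 l2 f1 f2 g1 g2 : echelon j l1 f1 g1 -> echelon j l2 f2 g2 ->
    plane_of j l1 f1 g1 = plane_of j l2 f2 g2 -> (l1 <= l2)%N.
  move=> E1 E2 EP; rewrite leqNgt; apply/negP=> lt.
  have := second_in j l2 f2 g2; rewrite -EP => /(plane_coord E1)/rowP/(_ l2)/eqP.
  rewrite lincombE (second_before E2 (ech_lt E2)) mul0r add0r.
  by rewrite (second_before E1) // mulr0 (second_at_second E2) oner_eq0.
move=> E E' EP.
have ii : i = i'.
  apply/val_inj/eqP; rewrite eqn_leq; apply/andP; split; first exact: le1 E E' EP.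
  exact: le1 E' E (esym EP).
subst i'.
have kk : k = k'.
  apply/val_inj/eqP; rewrite eqn_leq; apply/andP; split; first exact: le2 E E' EP.
  exact: le2 E' E (esym EP).
subst k'.
have gg : pivot_row k g' = pivot_row k g.
  have := second_in i k f' g'; rewrite -EP => /(plane_coord E) ->.
  by rewrite (second_before E' (ech_lt E)) (second_at_second E') scale0r add0r scale1r.
have ff : pivot_row i f' = pivot_row i f.
  have := first_in i k f' g'; rewrite -EP => /(plane_coord E) ->.
  by rewrite (first_at_first E') (first_at_second E') scale0r addr0 scale1r.
have pinj l (h h' : word) : pivot_row l h' = pivot_row l h -> h = h'.
  by move/rowP=> H; apply/ffunP=> j; have := H j; rewrite !mxE => /addIr.
by rewrite (pinj _ _ _ ff) (pinj _ _ _ gg).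
Qed.

(** Choose [u] with the earliest possible leading position [i], then [v] with the
    earliest leading position [k] among the vectors vanishing at [i]; normalize
    both and clear the entry of [u] at [k]. *)
Lemma echelon_surj V : \dim V = 2%N ->
  exists i k f g, echelon i k f g /\ V = plane_of i k f g.
Proof.
move=> dV.
have minpos (P : pred vT) : (exists2 u, u != 0 & P u) ->
    exists u (i : 'I_n), [/\ P u, u 0 i != 0 &
      forall w (j : 'I_n), P w -> (j < i)%N -> w 0 j = 0].
  case=> u0 u00 Pu0.
  have [i0 ui0] : exists i, u0 0 i != 0.
    apply/existsP; apply: contraNT u00; rewrite negb_exists => /forallP H.
    by apply/eqP/rowP=> i; rewrite mxE; apply/eqP; rewrite -[_ == _]negbK.
  pose Q := [pred i : 'I_n | [exists u, P u && (u 0 i != 0)]].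
  have Q0 : Q i0 by apply/existsP; exists u0; rewrite Pu0.
  case: (arg_minnP (fun i : 'I_n => val i) Q0) => i /existsP[u /andP[Pu ui]] imin.
  exists u, i; split=> // w j Pw ji; apply/eqP; apply: contraTT ji => wj.
  by rewrite -leqNgt imin //; apply/existsP; exists w; rewrite Pw.
have [|u [i [uV ui before_i]]] := minpos (fun u => u \in V).
  by exists (vpick V); rewrite ?memv_pick // vpick0 -dimv_eq0 dV.
have u0 : u != 0 by apply: contraNneq ui => ->; rewrite mxE.
have [|v [k [/andP[vV /eqP vi] vk before_k]]] := minpos (fun v => (v \in V) && (v 0 i == 0)).
  have /subvPn[w wV wu] : ~~ (V <= <[u]>)%VS.
    by apply: contraTN isT => /dimvS; rewrite dV dim_vline u0.
  exists (w - (w 0 i / u 0 i) *: u).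
    by rewrite subr_eq0; apply: contraNneq wu => ->; rewrite memvZ ?memv_line.
  by rewrite rpredB ?rpredZ //= !mxE divfK // subrr.
have ik : (i < k)%N.
  rewrite ltn_neqAle; apply/andP; split.
    by apply: contraNneq vk => /val_inj <-; rewrite vi.
  by rewrite leqNgt; apply/negP=> ki; case/eqP: vk; apply: before_i ki.
pose v' := (v 0 k)^-1 *: v; pose u' := (u 0 i)^-1 *: u.
pose r := u' - u' 0 k *: v'.
pose f := [ffun j => r 0 j - (j == i)%:R] : word.
pose g := [ffun j => v' 0 j - (j == k)%:R] : word.
have v'V : v' \in V by rewrite memvZ.
have rV : r \in V by rewrite rpredB ?rpredZ.
have fr : pivot_row i f = r by apply/rowP=> j; rewrite !(mxE, ffunE) subrK.
have gv : pivot_row k g = v' by apply/rowP=> j; rewrite !(mxE, ffunE) subrK.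
have v'k : v' 0 k = 1 by rewrite mxE mulVf.
have v'i : v' 0 i = 0 by rewrite mxE vi mulr0.
have ri : r 0 i = 1 by rewrite /r !mxE vi !mulr0 subr0 mulVf.
have rk : r 0 k = 0 by rewrite /r [LHS]mxE [X in _ + X]mxE [X in _ - X]mxE v'k mulr1 subrr.
have E : echelon i k f g.
  split=> //; apply/vectorsP=> j; rewrite inE ffunE.
    rewrite negb_and negbK -leqNgt => /orP[|/eqP->]; last first.
      by rewrite rk -val_eqE gtn_eqF // subrr.
    rewrite leq_eqVlt => /orP[/eqP/val_inj->|ji]; first by rewrite ri eqxx subrr.
    by rewrite -val_eqE ltn_eqF // subr0; apply: before_i ji.
  rewrite -leqNgt leq_eqVlt => /orP[/eqP/val_inj->|jk].
    by rewrite v'k eqxx subrr.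
  rewrite -val_eqE ltn_eqF // subr0; apply: before_k jk.
  by rewrite v'V v'i eqxx.
exists i, k, f, g; split=> //; rewrite /plane_of; apply: plane_eq => //.
- by rewrite fr.
- by rewrite gv.
- exact: first_neq0 E.
- exact: second_notin E.
Qed.

End Echelon.

(** * Counting the planes with a light vector *)

Section Count.
Variables (F : finFieldType) (n d : nat).
Local Notation vT := 'rV[F]_n.
Local Notation q := #|F|.
Local Notation word := {ffun 'I_n -> F}.
Implicit Types (u v w : vT) (V : {vspace vT}) (f g : word) (i k : 'I_n).

Lemma hamming_weight_pivot i f : f i = 0 -> hamming_weight (pivot_row i f) = (weight f).+1.
Proof.
move=> fi; rewrite /hamming_weight (_ : [set _ | _] = i |: nonzero_at 0 f).
  by rewrite cardsU1 inE fi eqxx.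
apply/setP=> j; rewrite !inE mxE; case: (eqVneq j i) => [->|ji] /=; last by rewrite addr0.
by rewrite fi add0r oner_eq0.
Qed.

Lemma hamming_weight_combination i k f g a : echelon i k f g -> a != 0 ->
  hamming_weight (pivot_row i f - a *: pivot_row k g) = (weight (sub_multiple a f g)).+2.
Proof.
move=> E a0; have ik : i != k by rewrite -val_eqE ltn_eqF // (ech_lt E).
rewrite /hamming_weight (_ : [set _ | _] = i |: (k |: nonzero_at 0 (sub_multiple a f g))).
  rewrite !cardsU1 !inE (negPf ik) !ffunE.
  rewrite !(vectorsP _ _ (ech_first E)) ?inE ?ltnn ?eqxx ?andbF //.
  rewrite !(vectorsP _ _ (ech_second E)) ?inE ?ltnn //.
    by rewrite mulr0 subr0 eqxx.
  by rewrite -leqNgt ltnW // (ech_lt E).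
apply/setP=> j; rewrite !inE.
case: (eqVneq j i) => [->|ji] /=.
  rewrite [X in X != _]mxE [X in _ + X]mxE [X in _ - X]mxE (first_at_first E).
  by rewrite (second_before E (ech_lt E)) mulr0 subr0 oner_eq0.
case: (eqVneq j k) => [->|jk] /=.
  rewrite [X in X != _]mxE [X in _ + X]mxE [X in _ - X]mxE (first_at_second E).
  by rewrite (second_at_second E) mulr1 sub0r oppr_eq0.
by rewrite !(mxE, ffunE) (negPf ji) (negPf jk) !addr0.
Qed.

Lemma low_lines_gt0 V : (0 < #|low_lines d V|)%N = [exists v, (v \in V) && low_vector d v].
Proof.
have q1 : (0 < q - 1)%N by rewrite subn_gt0 finNzRing_gt1.
have -> : (0 < #|low_lines d V|)%N = (0 < #|low_lines d V| * (q - 1))%N.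
  by rewrite muln_gt0 q1 andbT.
rewrite card_low_lines.
by apply/card_gt0P/existsP => -[v]; rewrite ?inE => vP; exists v; rewrite ?inE.
Qed.

(** Up to a nonzero scalar, the nonzero vectors of the plane are the second row,
    the first row, and the first row minus a nonzero multiple of the second. *)
Lemma low_plane_of i k f g : echelon i k f g ->
  (0 < #|low_lines d (plane_of i k f g)|)%N = low_pair d f g.
Proof.
move=> E; rewrite low_lines_gt0.
have fi : f i = 0 by apply: (vectorsP _ _ (ech_first E)); rewrite inE ltnn.
have gk : g k = 0 by apply: (vectorsP _ _ (ech_second E)); rewrite inE ltnn.
set u := pivot_row i f; set v := pivot_row k g.
have u0 : u != 0 := first_neq0 E.
have v0 : v != 0 by apply: contraNneq (second_notin E); rewrite -/v => ->; rewrite mem0v.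
apply/existsP/or3P.
  case=> w /andP[/mem_plane[a [b ->]]]; rewrite -/u -/v /low_vector => /andP[w0 ww].
  case: (eqVneq a 0) => [a0|a0].
    move: w0 ww; rewrite a0 scale0r add0r scaler_eq0 (negPf v0) orbF => b0.
    by rewrite hamming_weightZ // hamming_weight_pivot // => ww; apply: Or31.
  case: (eqVneq b 0) => [b0|b0].
    move: ww; rewrite b0 scale0r addr0 hamming_weightZ // hamming_weight_pivot // => ww.
    by apply: Or32.
  apply: Or33; apply/existsP; exists (- (b / a)).
  rewrite oppr_eq0 mulf_eq0 invr_eq0 (negPf a0) (negPf b0) /=.
  rewrite -(hamming_weight_combination E) ?oppr_eq0 ?mulf_eq0 ?invr_eq0 ?negb_or ?a0 ?b0 //.
  rewrite -(hamming_weightZ _ a0); move: ww.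
  by rewrite scalerBr scaleNr scalerN opprK scalerA mulrCA mulfV // mulr1.
have low_intro w : w \in plane_of i k f g -> w != 0 -> (hamming_weight w <= d)%N ->
    exists x, (x \in plane_of i k f g) && low_vector d x.
  by move=> wP w0 ww; exists w; rewrite wP /low_vector w0.
case=> [gd|fd|/existsP[a /andP[a0 wd]]].
- by apply: (low_intro v); rewrite ?second_in // hamming_weight_pivot.
- by apply: (low_intro u); rewrite ?first_in // hamming_weight_pivot.
apply: (low_intro (u - a *: v)); last by rewrite hamming_weight_combination.
  by rewrite rpredB ?rpredZ ?first_in ?second_in.
rewrite subr_eq0; apply: contraNneq (second_notin E) => uv.
by apply: (mem_vline_scale u0); rewrite -/u -/v uv memvZ ?memv_line.
Qed.

(** Reindexing of the planes by their echelon bases. *)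
Lemma sum_low_planes :
  (\sum_(V : {vspace vT} | \dim V == 2) (0 < #|low_lines d V|)
   = \sum_(i < n) \sum_(k < n | i < k)
       \sum_(g in vectors F (second_free k)) \sum_(f in vectors F (first_free i k))
         low_pair d f g)%N.
Proof.
rewrite pair_big_dep /=.
under [RHS]eq_bigr => p _ do rewrite pair_big /=.
rewrite pair_big_dep /=.
pose X := [set x : ('I_n * 'I_n) * (word * word) | (x.1.1 < x.1.2)%N &&
  ((x.2.1 \in vectors F (second_free x.1.2)) && (x.2.2 \in vectors F (first_free x.1.1 x.1.2)))].
pose P (x : ('I_n * 'I_n) * (word * word)) := plane_of x.1.1 x.1.2 x.2.2 x.2.1.
have XE x : x \in X -> echelon x.1.1 x.1.2 x.2.2 x.2.1.
  by rewrite inE => /and3P[].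
have -> : (\sum_(V : {vspace vT} | \dim V == 2) (0 < #|low_lines d V|)
   = \sum_(V in P @: X) (0 < #|low_lines d V|))%N.
  apply: eq_bigl => V; apply/eqP/imsetP => [/echelon_surj[i [k [f [g [E ->]]]]]|[x /XE E ->]].
    by case: (E) => *; exists ((i, k), (g, f)); rewrite // inE /=; apply/and3P.
  exact: dim_plane_of E.
rewrite big_imset /=; last first.
  move=> [[i k] [g f]] [[i' k'] [g' f']] /XE /= E /XE /= E' EP.
  by case: (echelon_inj E E' EP) => -> -> -> ->.
rewrite (eq_bigl _ _ (fun x => in_set _ x)).
by apply: eq_bigr => x Hx; rewrite low_plane_of //; apply: XE; rewrite inE.
Qed.

Lemma card_second_free k : #|second_free k| = (n - k.+1)%N.
Proof.
rewrite /second_free -sum1dep_card -(big_mkord (fun j : nat => k < j)%N (fun=> 1%N)).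
rewrite -(big_nat_widenl k.+1 0 n predT (fun=> 1%N)) //.
by rewrite sum_nat_const_nat muln1.
Qed.

Lemma card_first_free i k : (i < k)%N -> #|first_free i k| = (n - i.+1 - 1)%N.
Proof.
move=> ik; rewrite -card_second_free (cardsD1 k (second_free i)) inE ik addKn.
by apply: eq_card => j; rewrite !inE andbC.
Qed.

(** Pivots as ordinals count from [0], while the positions [l1 < l2] of the
    formula count from [1]. *)
Lemma sum_ord_pairs (H : nat -> nat -> nat) :
  (\sum_(i < n) \sum_(k < n | i < k) H i k
    = \sum_(1 <= l1 < n.+1) \sum_(l1.+1 <= l2 < n.+1) H l1.-1 l2.-1)%N.
Proof.
rewrite big_add1 /= big_mkord; apply: eq_bigr => i _.
rewrite big_add1 /= -(big_mkord (fun k : nat => i < k)%N (H i)).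
by rewrite [RHS](big_nat_widenl _ 0).
Qed.

End Count.

Theorem theorem8p2 (F : finFieldType) (q n d : nat)
    (hq : #|F| = q) (hd : (2 <= d)%N) (hdn : (d <= n)%N) :
  (whitney F n d 2)%:~R =
    (q%:R ^+ (n - 1) - 1) *
      (\sum_(1 <= j < d.+1) 'C(n, j)%:R * (q%:R - 1) ^ (j%:Z - 2%:Z))
    - \sum_(1 <= l1 < n.+1) \sum_(l1.+1 <= l2 < n.+1)
        (q%:R ^+ (n - l1 - 1) *
           (\sum_(0 <= j < d) 'C(n - l2, j)%:R * (q%:R - 1) ^+ j)
         + \sum_(d <= j < (n - l2).+1) \sum_(0 <= h < d)
             'C(n - l2, j)%:R * 'C(n - l1 - 1, h)%:R * (q%:R - 1) ^+ (j + h)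
         + \sum_(d <= s < (n - l2).+1) \sum_(0 <= t < d - 1)
             'C(n - l2, s)%:R * 'C(n - l1 - 1 - s, t)%:R
             * (q%:R - 1) ^+ (s + t)
             * (\sum_(d - t <= nu < s.+1)
                  (agreement q s (s - d + t + 2) nu)%:R))
  :> rat.
Proof.
have q1 : (1 < q)%N by rewrite -hq finNzRing_gt1.
have q0 : (0 < q)%N by apply: ltnW.
have qE : q%:R - 1 = (q - 1)%:R :> rat by rewrite natrB // ltnW.
rewrite whitney2E sumrB -!natr_sum rmorphB !rmorph_nat.
congr (_ - _).
  (* Solve the double count [a (q - 1) (q ^ 2 - q) = N (q ^ n - q)] for [a]; one
     factor [q] cancels, which gives [q ^ (n - 1) - 1]. *)
  have := sum_low_lines F n d; rewrite card_low_vectors hq.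
  move/(congr1 (fun x => x%:R : rat)); rewrite !natrM !natrB ?natrX //; last 2 first.
  - by rewrite -{1}[q]expn1 leq_exp2l // (leq_trans _ hdn) // ltnW.
  - by rewrite -{1}[q]expn1 leq_exp2l.
  set a := (\sum_(V | _) _)%:R => aE.
  have -> : \sum_(1 <= j < d.+1) 'C(n, j)%:R * (q%:R - 1) ^ (j%:Z - 2%:Z)
      = (\sum_(1 <= j < d.+1) 'C(n, j) * (q - 1) ^ j)%:R / (q%:R - 1) ^+ 2 :> rat.
    rewrite natr_sum mulr_suml; apply: eq_bigr => j _.
    by rewrite natrM natrX -qE expfzDr ?mulrA // qE pnatr_eq0 subn_eq0 -ltnNge.
  have qq : q%:R != 0 :> rat by rewrite pnatr_eq0 -lt0n ltnW.
  have qq1 : q%:R - 1 != 0 :> rat by rewrite qE pnatr_eq0 subn_eq0 -ltnNge.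
  have nE : q%:R ^+ n = q%:R * q%:R ^+ (n - 1) :> rat.
    by rewrite -exprS subn1 prednK // (leq_trans _ hdn) // ltnW.
  move: aE; rewrite nE; set N := (\sum_(1 <= j < _) _)%:R; set Q := q%:R ^+ (n - 1) => aE.
  have {}aE : a * (q%:R - 1) ^+ 2 = (Q - 1) * N.
    apply: (mulfI qq); transitivity (a * (q%:R - 1) * (q%:R ^+ 2 - q%:R)); first by ring.
    by rewrite aE; ring.
  by rewrite mulrA -aE mulfK // expf_neq0.
rewrite sum_low_planes.
(* [T a b] is the count for a pair of pivots whose rows have [a] and [b] free
   positions. *)
pose T a b := (q ^ a * (\sum_(0 <= j < d) 'C(b, j) * (q - 1) ^ j)
    + \sum_(d <= j < b.+1) \sum_(0 <= h < d) 'C(b, j) * 'C(a, h) * (q - 1) ^ (j + h)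
    + \sum_(d <= s < b.+1) \sum_(0 <= t < d - 1)
        'C(b, s) * 'C(a - s, t) * (q - 1) ^ (s + t)
        * (\sum_(d - t <= nu < s.+1) agreement q s (s - d + t + 2) nu))%N.
have TE : forall i k : 'I_n, (i < k)%N ->
  (\sum_(g in vectors F (second_free k)) \sum_(f in vectors F (first_free i k)) low_pair d f g)%N
  = T (n - i.+1 - 1)%N (n - k.+1)%N.
  move=> i k ik; rewrite sum_low_pair // ?card_second_free ?card_first_free ?hq //.
  apply/subsetP=> j; rewrite !inE => kj; rewrite (ltn_trans ik kj) /=.
  by rewrite -val_eqE gtn_eqF.
rewrite (eq_bigr _ (fun i _ => eq_bigr _ (fun k ik => TE i k ik))).
rewrite (sum_ord_pairs n (fun i k => T (n - i.+1 - 1)%N (n - k.+1)%N)) natr_sum.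
apply: eq_big_nat => l1 /andP[l10 _]; rewrite natr_sum.
apply: eq_big_nat => l2 /andP[l20 _].
rewrite !prednK //; last exact: leq_trans l20.
rewrite qE /T !natrD natrM natrX !natr_sum; congr (_ * _ + _ + _).
- by apply: eq_bigr => j _; rewrite natrM natrX.
- apply: eq_bigr => j _; rewrite natr_sum; apply: eq_bigr => h _.
  by rewrite !natrM natrX.
apply: eq_bigr => s _; rewrite natr_sum; apply: eq_bigr => t _.
by rewrite !natrM natrX natr_sum.
Qed.
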